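(* Let $\mathcal{H}_A,\mathcal{H}_B,\mathcal{H}_C$ be finite-dimensional Hilbert spaces, let $\rho_{ABC}$ be a pure state on $\mathcal{H}_A\otimes\mathcal{H}_B\otimes\mathcal{H}_C$, and let $Z=\{Z_j\}_{j=1}^N$ be a type of information about $A$. Then (i) $H(Z|C)=\min_{\sigma_{AB}} D\big(\rho_{AB}\,\big\|\,\sum_j Z_j\sigma_{AB}Z_j\big)$; (ii) $H_Q(Z|C)=\min_{\sigma_{AB}} D_{\mathrm{HS}}\big(\rho_{AB},\sum_j Z_j\sigma_{AB}Z_j\big)$; (iii) $p_{\mathrm{guess}}(Z|C)=\max_{\sigma_{AB}} F\big(\rho_{AB},\sum_j Z_j\sigma_{AB}Z_j\big)$, where the minima/maximum range over all density operators $\sigma_{AB}$ on $\mathcal{H}_A\otimes\mathcal{H}_B$, $\rho_{AB}=\mathrm{Tr}_C\rho_{ABC}$, and $Z_j$ acts as $Z_j\otimes I_B$.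
   Context: A type of information $Z=\{Z_j\}_{j=1}^N$ about $A$ is a set of mutually orthogonal projectors on $\mathcal{H}_A$ with $\sum_j Z_j=I_A$. Let $M_Z$ be a register with orthonormal basis $\{|j\rangle\}_{j=1}^N$ and $V_Z=\sum_j |j\rangle_{M_Z}\otimes Z_j$ (identity on $B,C$); set $\tilde\rho_{M_ZABC}=V_Z\rho_{ABC}V_Z^\dagger$. Its marginal is $\tilde\rho_{M_ZC}=\sum_j p_j|j\rangle\langle j|\otimes\rho_{C,j}$ with $p_j=\mathrm{Tr}(Z_j\rho_A)$ and $p_j\rho_{C,j}=\mathrm{Tr}_A[(Z_j\otimes I_C)\rho_{AC}]$. Definitions: $H(\rho)=-\mathrm{Tr}(\rho\log_2\rho)$; $H(Z|C)=H(\tilde\rho_{M_ZC})-H(\rho_C)$; $H_Q(Z|C)=\mathrm{Tr}(\rho_C^2)-\mathrm{Tr}(\tilde\rho_{M_ZC}^2)$; $p_{\mathrm{guess}}(Z|C)=\max_{Q}\sum_j p_j\mathrm{Tr}(Q_j\rho_{C,j})$, maximum over POVMs $Q=\{Q_j\}_{j=1}^N$ on $\mathcal{H}_C$. Relative entropy $D(\rho\|\sigma)=-H(\rho)-\mathrm{Tr}(\rho\log_2\sigma)$, Hilbert–Schmidt distance $D_{\mathrm{HS}}(\rho,\sigma)=\mathrm{Tr}[(\rho-\sigma)^2]$, fidelity $F(\rho,\sigma)=[\mathrm{Tr}(\sqrt{\rho}\sigma\sqrt{\rho})^{1/2}]^2$. *)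

(* Defs.v *)
From HB Require Import structures.
From mathcomp Require Import all_boot all_order all_algebra.
From mathcomp Require Import spectral.
From mathcomp Require Import complex.
From mathcomp Require mxtens.
From mathcomp Require Import boolp classical_sets reals ereal exp.

Set Implicit Arguments.
Unset Strict Implicit.
Unset Printing Implicit Defensive.
Import Order.TTheory GRing.Theory Num.Theory.
Local Open Scope ring_scope.

Notation idx := mxtens.mxtens_index.
Notation tensmx := mxtens.tensmx.

Section Quantum.
Variable R : realType.
Local Notation C := R[i].

Definition dag {m n} (A : 'M[C]_(m, n)) : 'M[C]_(n, m) := (map_mx Num.conj A)^T.

Definition hermitian {n} (A : 'M[C]_n) : Prop := dag A = A.

(* positive semidefinite (0 <= z in C means z is a nonnegative real) *)
Definition psd {n} (A : 'M[C]_n) : Prop :=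
  hermitian A /\ forall v : 'cV[C]_n, 0 <= (dag v *m A *m v) 0 0.

Definition density {n} (A : 'M[C]_n) : Prop := psd A /\ \tr A = 1.

Definition pure_state {n} (rho : 'M[C]_n) : Prop :=
  exists psi : 'cV[C]_n, dag psi *m psi = 1 /\ rho = psi *m dag psi.

Definition reC (z : C) : R := complex.Re z.

(* f(A) for a normal (in practice Hermitian) matrix A, via the spectral
   decomposition A = P^-1 diag(d) P of mathcomp's spectral.v; f is applied
   to the (real) eigenvalues. *)
Definition mxfun {n} (f : R -> R) (A : 'M[C]_n) : 'M[C]_n :=
  let P := spectralmx A in
  invmx P *m diag_mx (map_mx (fun z : C => complex.real_complex R (f (reC z)))
                              (spectral_diag A)) *m P.

(* logarithm in base 2, with the convention log2 x = 0 for x <= 0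
   (so that 0 log 0 = 0, and the log of a PSD matrix is taken on its support) *)
Definition log2 (x : R) : R := if 0 < x then ln x / ln 2 else 0.

Definition vN_entropy {n} (rho : 'M[C]_n) : R :=
  - reC (\tr (rho *m mxfun log2 rho)).

Definition supp_le {n} (rho sigma : 'M[C]_n) : Prop :=
  forall v : 'cV[C]_n, sigma *m v = 0 -> rho *m v = 0.

Definition rel_entropy {n} (rho sigma : 'M[C]_n) : \bar R :=
  if `[< supp_le rho sigma >]
  then ((- vN_entropy rho) - reC (\tr (rho *m mxfun log2 sigma)))%:E
  else +oo%E.

Definition D_HS {n} (rho sigma : 'M[C]_n) : R :=
  reC (\tr ((rho - sigma) *m (rho - sigma))).

Definition fidelity {n} (rho sigma : 'M[C]_n) : R :=
  let sr := mxfun Num.sqrt rho in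
  (reC (\tr (mxfun Num.sqrt (sr *m sigma *m sr)))) ^+ 2.

(* ---- tensor products: H_X (x) H_Y has dimension m * n, basis index
        idx (x, y) (mathcomp-real-closed mxtens convention) ---- *)

Definition ptr2 {m n} (X : 'M[C]_(m * n)) : 'M[C]_m :=
  \matrix_(i, j) \sum_(k < n) X (idx (i, k)) (idx (j, k)).

Definition ptr1 {m n} (X : 'M[C]_(m * n)) : 'M[C]_n :=
  \matrix_(k, l) \sum_(i < m) X (idx (i, k)) (idx (i, l)).

Definition ptrB {dA dB dC} (X : 'M[C]_(dA * dB * dC)) : 'M[C]_(dA * dC) :=
  \matrix_(i, j) \sum_(b < dB)
     X (idx (idx ((mxtens.mxtens_unindex i).1, b), (mxtens.mxtens_unindex i).2))
       (idx (idx ((mxtens.mxtens_unindex j).1, b), (mxtens.mxtens_unindex j).2)).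

Definition type_of_info {dA N} (Z : 'I_N -> 'M[C]_dA) : Prop :=
  [/\ forall j, hermitian (Z j),
      forall j k, Z j *m Z k = if j == k then Z j else 0
    & \sum_(j < N) Z j = 1%:M].

Section Info.
Variables (dA dB dC N : nat) (rho : 'M[C]_(dA * dB * dC)) (Z : 'I_N -> 'M[C]_dA).

Definition rho_AB : 'M[C]_(dA * dB) := ptr2 rho.
Definition rho_C : 'M[C]_dC := ptr1 rho.
Definition rho_AC : 'M[C]_(dA * dC) := ptrB rho.

(* p_j rho_{C,j} = Tr_A[(Z_j (x) I_C) rho_AC] *)
Definition cond_block (j : 'I_N) : 'M[C]_dC :=
  ptr1 (tensmx (Z j) (1%:M : 'M[C]_dC) *m rho_AC).

Definition rho_MZC : 'M[C]_(N * dC) :=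
  \sum_(j < N) tensmx (delta_mx j j : 'M[C]_N) (cond_block j).

Definition cond_entropy : R := vN_entropy rho_MZC - vN_entropy rho_C.

Definition cond_entropy_Q : R :=
  reC (\tr (rho_C *m rho_C)) - reC (\tr (rho_MZC *m rho_MZC)).

Definition povm (Q : 'I_N -> 'M[C]_dC) : Prop :=
  (forall j, psd (Q j)) /\ \sum_(j < N) Q j = 1%:M.

Definition p_guess : R :=
  sup [set x : R | exists Q, povm Q /\
         x = reC (\sum_(j < N) \tr (Q j *m cond_block j))].

Definition dephase (sigma : 'M[C]_(dA * dB)) : 'M[C]_(dA * dB) :=
  \sum_(j < N) (tensmx (Z j) (1%:M : 'M[C]_dB) *m sigma
                  *m tensmx (Z j) (1%:M : 'M[C]_dB)).

End Info.
End Quantum.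

(* Main.v *)
(** Write the pure state as an operator M from C to AB and put P_j = Z_j (x) 1.
    Then rho_AB = M M^*, while rho_C and p_j rho_(C,j) are the transposes of
    M^* M and M^* P_j M; and rho_(MZ C) is the transpose of X^* X, where X is
    the block row of the P_j M, with X X^* = Delta(rho_AB), Delta being the
    pinching by the P_j.  As tr f(X X^* ) = tr f(X^* X) when f 0 = 0, parts (i)
    and (ii) say that D(rho || Delta sigma), resp. the squared distance of rho
    to Delta sigma, is minimal at sigma = rho; the excess is
    D(Delta rho || Delta sigma) >= 0 by Klein's inequality, resp.
    |Delta rho - Delta sigma|^2.

    For (iii), sqrt F(M M^*, tau) = tr sqrt(M^* tau M).  Given sigma, put
    G = sqrt(M^* Delta(sigma) M) with pseudo-inverse G^+ and
    E_j = sqrt(sigma) P_j M G^+: by Cauchy-Schwarz (tr G)^2 is at most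
    sum_j tr(E_j^* E_j M^* P_j M), and the E_j^* E_j complete to a POVM.
    Conversely a POVM Q with value g gives sigma = L L^* / g, where
    L = sum_j P_j M sqrt(Q_j), whose fidelity is at least g.  An optimal POVM
    exists because the families E with sum_j E_j^* E_j = 1 form a compact set. *)

Require Import Defs.
From HB Require Import structures.
From mathcomp Require Import all_boot all_order all_algebra.
From mathcomp Require Import complex boolp classical_sets reals ereal.
From mathcomp Require Import spectral exp topology normedtype derive lra.
Import Order.TTheory GRing.Theory Num.Theory.
Import numFieldNormedType.Exports.
Local Open Scope ring_scope.

Set Implicit Arguments.
Unset Strict Implicit.
Unset Printing Implicit Defensive.

(** * Adjoints and positive semidefinite matrices *)

Section Adjoint.
Variable R : realType.
Local Notation C := R[i].

Lemma dagE m n (A : 'M[C]_(m, n)) i j : dag A i j = (A j i)^*.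
Proof. by rewrite /dag !mxE. Qed.

Lemma dagK m n (A : 'M[C]_(m, n)) : dag (dag A) = A.
Proof. by apply/matrixP => i j; rewrite !dagE conjCK. Qed.

Lemma dagD m n (A B : 'M[C]_(m, n)) : dag (A + B) = dag A + dag B.
Proof. by rewrite /dag map_mxD linearD. Qed.

Lemma dagB m n (A B : 'M[C]_(m, n)) : dag (A - B) = dag A - dag B.
Proof. by rewrite /dag map_mxB linearB. Qed.

Lemma dagM m n p (A : 'M[C]_(m, n)) (B : 'M[C]_(n, p)) :
  dag (A *m B) = dag B *m dag A.
Proof. by rewrite /dag map_mxM trmx_mul. Qed.

Lemma dagZ m n (c : C) (A : 'M[C]_(m, n)) : dag (c *: A) = c^* *: dag A.
Proof. by rewrite /dag map_mxZ linearZ. Qed.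

Lemma dag1 n : dag (1%:M : 'M[C]_n) = 1%:M.
Proof. by rewrite /dag map_mx1 trmx1. Qed.

Lemma dag_sum m n (I : finType) (F : I -> 'M[C]_(m, n)) :
  dag (\sum_i F i) = \sum_i dag (F i).
Proof.
by apply/matrixP => i j; rewrite dagE !summxE rmorph_sum; apply: eq_bigr => k _; rewrite dagE.
Qed.

Lemma trmx_dag m n (A : 'M[C]_(m, n)) : (dag A)^T = dag A^T.
Proof. by apply/matrixP => i j; rewrite !mxE. Qed.

(** * Real parts, and traces of Gram matrices *)

Lemma reCD (x y : C) : reC (x + y) = reC x + reC y.
Proof. by case: x y => [a b] [c d]. Qed.

Lemma reCN (x : C) : reC (- x) = - reC x.
Proof. by case: x. Qed.

Lemma reCB (x y : C) : reC (x - y) = reC x - reC y.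
Proof. by rewrite reCD reCN. Qed.

Lemma reC0 : reC (0 : C) = 0. Proof. by []. Qed.

Lemma reC_sum (I : Type) (r : seq I) (P : pred I) (F : I -> C) :
  reC (\sum_(i <- r | P i) F i) = \sum_(i <- r | P i) reC (F i).
Proof. exact: (big_morph _ reCD reC0). Qed.

Lemma reC_conj (x : C) : reC x^* = reC x.
Proof. by case: x. Qed.

Lemma reCZ (a : R) (x : C) : reC (real_complex R a * x) = a * reC x.
Proof. by case: x => b c; rewrite /reC /= mul0r subr0. Qed.

Lemma reC_real (a : R) : reC (real_complex R a) = a.
Proof. by []. Qed.

Lemma reC_ge0 (x : C) : 0 <= x -> 0 <= reC x.
Proof. by rewrite lecE => /andP[]. Qed.

Lemma ge0_reCK (x : C) : 0 <= x -> real_complex R (reC x) = x.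
Proof. by move=> /ger0_real /RRe_real. Qed.

Lemma conj_real (a : R) : (real_complex R a)^* = real_complex R a :> C.
Proof. exact: conjc_real. Qed.

Lemma tr_dag n (A : 'M[C]_n) : \tr (dag A) = (\tr A)^*.
Proof. by rewrite /mxtrace rmorph_sum; apply: eq_bigr => i _; rewrite dagE. Qed.

Lemma tr_dag_mul m n (X : 'M[C]_(m, n)) :
  \tr (dag X *m X) = \sum_j \sum_i `|X i j| ^+ 2.
Proof.
by apply: eq_bigr => j _; rewrite mxE; apply: eq_bigr => i _; rewrite dagE mulrC -normCK.
Qed.

Lemma tr_dag_mul_ge0 m n (X : 'M[C]_(m, n)) : 0 <= \tr (dag X *m X).
Proof.
by rewrite tr_dag_mul; apply: sumr_ge0 => j _; apply: sumr_ge0 => i _; rewrite exprn_ge0.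
Qed.

Lemma tr_dag_mul_eq0 m n (X : 'M[C]_(m, n)) : \tr (dag X *m X) = 0 -> X = 0.
Proof.
rewrite tr_dag_mul => /eqP.
rewrite psumr_eq0; last by move=> j _; apply: sumr_ge0 => i _; rewrite exprn_ge0.
move=> /allP h; apply/matrixP => i j; rewrite mxE; apply/eqP.
have := h j (mem_index_enum _); rewrite psumr_eq0; last by move=> k _; rewrite exprn_ge0.
by move=> /allP /(_ i (mem_index_enum _)); rewrite expf_eq0 normr_eq0.
Qed.

Lemma dag_mul_eq0 m n (X : 'M[C]_(m, n)) : dag X *m X = 0 -> X = 0.
Proof. by move=> h; apply: tr_dag_mul_eq0; rewrite h mxtrace0. Qed.

(** * Closure properties of positive semidefinite matrices *)

Lemma psd_gram m n (X : 'M[C]_(m, n)) : psd (dag X *m X).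
Proof.
split=> [|v]; first by rewrite /Defs.hermitian dagM dagK.
by have := tr_dag_mul_ge0 (X *m v); rewrite dagM !mulmxA trace_mx11.
Qed.

Lemma psd_congr m n (A : 'M[C]_m) (X : 'M[C]_(m, n)) :
  psd A -> psd (dag X *m A *m X).
Proof.
move=> [hA pA]; split=> [|v]; first by rewrite /Defs.hermitian !dagM dagK hA mulmxA.
by have := pA (X *m v); rewrite dagM !mulmxA.
Qed.

Lemma psdD n (A B : 'M[C]_n) : psd A -> psd B -> psd (A + B).
Proof.
move=> [hA pA] [hB pB]; split=> [|v]; first by rewrite /Defs.hermitian dagD hA hB.
by rewrite mulmxDr mulmxDl mxE addr_ge0.
Qed.

Lemma psd0 n : psd (0 : 'M[C]_n).
Proof.
split=> [|v]; last by rewrite mulmx0 mul0mx mxE.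
by rewrite /Defs.hermitian /dag map_mx0 trmx0.
Qed.

Lemma psd_sum n (I : finType) (F : I -> 'M[C]_n) :
  (forall i, psd (F i)) -> psd (\sum_i F i).
Proof.
by move=> h; apply: (big_ind (fun A => psd A)) => [|A B|i _ //]; [exact: psd0 | exact: psdD].
Qed.

Lemma psdZ n (c : C) (A : 'M[C]_n) : 0 <= c -> psd A -> psd (c *: A).
Proof.
move=> c0 [hA pA]; split=> [|v].
  by rewrite /Defs.hermitian dagZ hA conj_Creal // ger0_real.
by rewrite -scalemxAr -scalemxAl mxE mulr_ge0.
Qed.

(** The form of [A^T] at [v] is the form of [A] at the conjugate of [v]. This lets POVMs be
    transposed along with the marginals on C. *)
Lemma psd_tr n (A : 'M[C]_n) : psd A -> psd A^T.
Proof.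
move=> [hA pA]; split=> [|v]; first by rewrite /Defs.hermitian -trmx_dag hA.
have -> : (dag v *m A^T *m v) 0 0 = (dag (map_mx Num.conj v) *m A *m map_mx Num.conj v) 0 0.
  rewrite -[LHS]trace_mx11 -mxtrace_tr !trmx_mul trmxK trace_mx11 mulmxA.
  congr ((_ *m _ *m _) 0 0); apply/matrixP => i j; rewrite !mxE ?conjCK //.
exact: pA.
Qed.

(* Expanding 0 <= ||X - tY||^2 at t = Re <Y, X>. *)
Lemma tr_cauchy_schwarz m n (X Y : 'M[C]_(m, n)) :
  reC (\tr (dag Y *m Y)) = 1 ->
  reC (\tr (dag Y *m X)) ^+ 2 <= reC (\tr (dag X *m X)).
Proof.
have trB (A B : 'M[C]_n) : \tr (A - B) = \tr A - \tr B by exact: raddfB.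
move=> hY; set b := reC (\tr (dag Y *m X)).
have := reC_ge0 (tr_dag_mul_ge0 (X - real_complex R b *: Y)).
rewrite dagB dagZ conj_real !(mulmxBl, mulmxBr) -!scalemxAl -!scalemxAr.
rewrite !trB !mxtraceZ !reCB !reCZ hY.
have -> : reC (\tr (dag X *m Y)) = b.
  by rewrite /b -[dag Y *m X]dagK tr_dag reC_conj dagM dagK.
by rewrite -/b mulr1 subrr subr0 subr_ge0 expr2.
Qed.

End Adjoint.

(** * Functional calculus of Hermitian matrices *)

(* Locked copies: matching up to conversion would otherwise unfold the spectral decomposition. *)
HB.lock Definition eigvec (R : realType) n (A : 'M[R[i]]_n) : 'M[R[i]]_n := spectralmx A.
HB.lock Definition eigval (R : realType) n (A : 'M[R[i]]_n) (i : 'I_n) : R :=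
  reC (spectral_diag A 0 i).
HB.lock Definition mfun (R : realType) n (f : R -> R) (A : 'M[R[i]]_n) : 'M[R[i]]_n :=
  mxfun f A.

Section FunctionalCalculus.
Variable R : realType.
Local Notation C := R[i].
Local Notation rC := (real_complex R).

Definition rdiag n (e : 'I_n -> R) : 'M[C]_n := diag_mx (\row_i rC (e i)).

Lemma rdiagE n (e : 'I_n -> R) i j : rdiag e i j = rC (e i) *+ (i == j).
Proof. by rewrite !mxE. Qed.

Lemma mul_rdiag_mx m n (e : 'I_m -> R) (A : 'M[C]_(m, n)) i j :
  (rdiag e *m A) i j = rC (e i) * A i j.
Proof. by rewrite mul_diag_mx !mxE. Qed.

Lemma mul_mx_rdiag m n (e : 'I_n -> R) (A : 'M[C]_(m, n)) i j :
  (A *m rdiag e) i j = A i j * rC (e j).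
Proof. by rewrite mul_mx_diag !mxE. Qed.

Lemma rdiagM n (d e : 'I_n -> R) : rdiag d *m rdiag e = rdiag (fun i => d i * e i).
Proof.
by apply/matrixP => i j; rewrite mul_rdiag_mx !rdiagE mulrnAr -rmorphM.
Qed.

Lemma dag_rdiag n (e : 'I_n -> R) : dag (rdiag e) = rdiag e.
Proof.
apply/matrixP => i j; rewrite dagE !rdiagE eq_sym.
by case: eqP => [->|_]; rewrite ?mulr1n ?conj_real // mulr0n conjC0.
Qed.

Lemma eigvec_dagr n (A : 'M[C]_n) : eigvec A *m dag (eigvec A) = 1%:M.
Proof.
by rewrite eigvec.unlock; have /unitarymxP := spectral_unitarymx A; rewrite /dag map_trmx.
Qed.

Lemma eigvec_dagl n (A : 'M[C]_n) : dag (eigvec A) *m eigvec A = 1%:M.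
Proof. exact/mulmx1C/eigvec_dagr. Qed.

Lemma mxfun_mfun n f (A : 'M[C]_n) : mxfun f A = mfun f A.
Proof. by rewrite mfun.unlock. Qed.

Lemma invmx_eigvec n (A : 'M[C]_n) : invmx (eigvec A) = dag (eigvec A).
Proof.
have [Pu _] := mulmx1_unit (eigvec_dagr A).
by rewrite -[RHS](mulKmx Pu) eigvec_dagr mulmx1.
Qed.

Lemma mfunE n f (A : 'M[C]_n) :
  mfun f A = dag (eigvec A) *m rdiag (f \o eigval A) *m eigvec A.
Proof.
rewrite mfun.unlock /mxfun -[spectralmx A](congr1 (fun f => f R n A) eigvec.unlock) invmx_eigvec.
congr (_ *m diag_mx _ *m _).
by apply/rowP => i; rewrite !mxE /= eigval.unlock.
Qed.

Lemma spectral_decomp n (A : 'M[C]_n) : Defs.hermitian A ->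
  A = dag (eigvec A) *m rdiag (eigval A) *m eigvec A.
Proof.
move=> hA.
have hA' : A \is hermsymmx.
  apply/is_hermitianmxP; rewrite expr0 scale1r.
  by rewrite -[LHS]hA /dag -map_trmx.
have /orthomx_spectralP {1}-> := hermitian_normalmx hA'.
have sR := hermitian_spectral_diag_real hA'.
rewrite -[spectralmx A](congr1 (fun f => f R n A) eigvec.unlock) invmx_eigvec.
congr (_ *m diag_mx _ *m _).
apply/rowP => i; rewrite !mxE.
rewrite eigval.unlock RRe_real //.
by move/mxOverP: sR; apply.
Qed.

Lemma mfun_id n (A : 'M[C]_n) : Defs.hermitian A -> mfun id A = A.
Proof. by move=> hA; rewrite mfunE; exact: esym (spectral_decomp hA). Qed.

Lemma mfun_cst1 n (A : 'M[C]_n) : mfun (fun=> 1) A = 1%:M.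
Proof.
rewrite mfunE (_ : rdiag _ = 1%:M) ?mulmx1 ?eigvec_dagl //.
by apply/matrixP => i j; rewrite rdiagE mxE.
Qed.

Lemma mfunM n f g (A : 'M[C]_n) :
  mfun f A *m mfun g A = mfun (fun x => f x * g x) A.
Proof.
by rewrite !mfunE !mulmxA -(mulmxA _ (eigvec A) (dag _)) eigvec_dagr mulmx1
  -(mulmxA _ (rdiag _) (rdiag _)) rdiagM.
Qed.

Lemma mfun_herm n f (A : 'M[C]_n) : Defs.hermitian (mfun f A).
Proof. by rewrite /Defs.hermitian mfunE !dagM dagK dag_rdiag mulmxA. Qed.

Lemma eq_mfun n f g (A : 'M[C]_n) :
  (forall i, f (eigval A i) = g (eigval A i)) -> mfun f A = mfun g A.
Proof.
move=> fg; rewrite !mfunE; congr (_ *m _ *m _).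
by apply/matrixP => i j; rewrite !rdiagE /= fg.
Qed.

Lemma psd_rdiag n (e : 'I_n -> R) : (forall i, 0 <= e i) -> psd (rdiag e).
Proof.
move=> e0; rewrite (_ : rdiag e = dag (rdiag (Num.sqrt \o e)) *m rdiag (Num.sqrt \o e)).
  exact: psd_gram.
rewrite dag_rdiag rdiagM; apply/matrixP => i j; rewrite !rdiagE /=.
by rewrite -expr2 sqr_sqrtr.
Qed.

Lemma psd_mfun n f (A : 'M[C]_n) :
  (forall i, 0 <= f (eigval A i)) -> psd (mfun f A).
Proof. by move=> f0; rewrite mfunE; apply/psd_congr/psd_rdiag. Qed.

Lemma eigval_ge0 n (A : 'M[C]_n) i : psd A -> 0 <= eigval A i.
Proof.
move=> pA; have [hA _] := pA.
(* [eigval A i] is the value at the i-th basis vector of the form of [A] written in its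
   eigenbasis. *)
have [_ /(_ (delta_mx i 0))] : psd (rdiag (eigval A)).
  have := psd_congr (dag (eigvec A)) pA.
  rewrite [X in _ *m X *m _](spectral_decomp hA) dagK !mulmxA eigvec_dagr mul1mx.
  by rewrite -mulmxA eigvec_dagr mulmx1.
rewrite -mulmxA mxE (bigD1 i) //= big1 ?addr0 => [|j ji]; last first.
  by rewrite dagE mxE (negPf ji) conjC0 mul0r.
rewrite dagE mxE !eqxx conjC1 mul1r mul_rdiag_mx mxE !eqxx mulr1.
by rewrite ler0c.
Qed.

Lemma sqrt_psd_sqr n (A : 'M[C]_n) : psd A ->
  mfun Num.sqrt A *m mfun Num.sqrt A = A.
Proof.
move=> pA; have [hA _] := pA; rewrite mfunM -[RHS](mfun_id hA).
by apply: eq_mfun => i; rewrite -expr2 sqr_sqrtr ?eigval_ge0.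
Qed.

(** Entrywise, [(d i - e j) * Y i j = 0]: either the entry of [Y] vanishes or the two eigenvalues
    agree, and then so do their images under [f]. No polynomial interpolation of [f] is involved. *)
Lemma intertwine_rdiag m n (d : 'I_m -> R) (e : 'I_n -> R) (Y : 'M[C]_(m, n)) (f : R -> R) :
  rdiag d *m Y = Y *m rdiag e -> rdiag (f \o d) *m Y = Y *m rdiag (f \o e).
Proof.
move=> /matrixP h; apply/matrixP => i j; have := h i j.
rewrite !mul_rdiag_mx !mul_mx_rdiag /= mulrC => /eqP.
rewrite -subr_eq0 -mulrBr mulf_eq0 => /orP[/eqP ->|]; first by rewrite mulr0 mul0r.
by rewrite subr_eq0 => /eqP/complexI ->; rewrite mulrC.
Qed.

(** Conjugation by the unitaries reduces to the diagonal case. The diagonalisations are arbitrary,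
    so that ones other than those chosen by [eigvec] can be compared with it. *)
Lemma intertwine_decomp m n (P : 'M[C]_m) (Q : 'M[C]_n) d e (X : 'M[C]_(m, n)) (f : R -> R) :
  P *m dag P = 1%:M -> Q *m dag Q = 1%:M ->
  dag P *m rdiag d *m P *m X = X *m (dag Q *m rdiag e *m Q) ->
  dag P *m rdiag (f \o d) *m P *m X = X *m (dag Q *m rdiag (f \o e) *m Q).
Proof.
move=> PP QQ h; have PP' := mulmx1C PP; have QQ' := mulmx1C QQ.
have : rdiag d *m (P *m X *m dag Q) = P *m X *m dag Q *m rdiag e.
  have := congr1 (fun Z => P *m Z *m dag Q) h.
  by rewrite /= !mulmxA PP mul1mx -!mulmxA QQ mulmx1.
move=> /(@intertwine_rdiag _ _ _ _ _ f) h'.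
have := congr1 (fun Z => dag P *m Z *m Q) h'.
by rewrite /= !mulmxA PP' mul1mx -!mulmxA QQ' mulmx1.
Qed.

Lemma mfun_intertwine m n (A : 'M[C]_m) (B : 'M[C]_n) (X : 'M[C]_(m, n)) f :
  Defs.hermitian A -> Defs.hermitian B ->
  A *m X = X *m B -> mfun f A *m X = X *m mfun f B.
Proof.
move=> hA hB; rewrite {1}(spectral_decomp hA) {1}(spectral_decomp hB) !mfunE.
by apply: intertwine_decomp; exact: eigvec_dagr.
Qed.

Lemma mfun_tr n (A : 'M[C]_n) f : Defs.hermitian A -> mfun f A^T = (mfun f A)^T.
Proof.
move=> hA; have hAT : Defs.hermitian A^T by rewrite /Defs.hermitian -trmx_dag hA.
pose Q := map_mx Num.conj (eigvec A).
have dQ : dag Q = (eigvec A)^T by apply/matrixP => i j; rewrite !mxE conjCK.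
have QT : Q = (dag (eigvec A))^T by rewrite /dag trmxK.
have trE (e : 'I_n -> R) :
    (dag (eigvec A) *m rdiag e *m eigvec A)^T = dag Q *m rdiag e *m Q.
  by rewrite !trmx_mul dQ QT tr_diag_mx mulmxA.
(* The conjugate eigenvectors of [A] diagonalise [A^T], perhaps differently from [eigvec A^T];
   intertwining by the identity shows that both give the same function of [A^T]. *)
rewrite -[LHS]mulmx1 -[RHS]mul1mx !mfunE trE.
apply: intertwine_decomp; first exact: eigvec_dagr.
  by rewrite dQ QT -trmx_mul eigvec_dagr trmx1.
by rewrite -(spectral_decomp hAT) -trE -(spectral_decomp hA) mulmx1 mul1mx.
Qed.

(** Since f vanishes at 0, f(x) = x g(x) with g(x) = f(x) / x, also at x = 0. Then [X] intertwines g
    of the two Gram matrices, and cyclicity of the trace moves it across. *)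
Lemma tr_mfun_gram m n (X : 'M[C]_(m, n)) f : f 0 = 0 ->
  \tr (mfun f (X *m dag X)) = \tr (mfun f (dag X *m X)).
Proof.
move=> f0.
have h1 : Defs.hermitian (X *m dag X) by rewrite /Defs.hermitian dagM dagK.
have h2 : Defs.hermitian (dag X *m X) by rewrite /Defs.hermitian dagM dagK.
have fE k (A : 'M[C]_k) : Defs.hermitian A -> mfun f A = A *m mfun (fun x => f x / x) A.
  move=> hA; rewrite -{2}(mfun_id hA) mfunM; apply: eq_mfun => i.
  have [->|x0] := eqVneq (eigval A i) 0; first by rewrite f0 mul0r.
  by rewrite mulrC divfK.
rewrite !fE // mxtrace_mulC mulmxA (@mfun_intertwine _ _ _ (dag X *m X)) ?mulmxA //.
by rewrite mxtrace_mulC mulmxA.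
Qed.

(** The rows of [eigvec] are the adjoints of eigenvectors, so these are the squared moduli of the
    inner products between the eigenvectors of [A] and those of [B]. *)
Definition overlap n (A B : 'M[C]_n) (i j : 'I_n) : R :=
  reC (`|(eigvec A *m dag (eigvec B)) i j| ^+ 2).

Lemma overlapE n (A B : 'M[C]_n) i j :
  rC (overlap A B i j) = `|(eigvec A *m dag (eigvec B)) i j| ^+ 2.
Proof. by rewrite ge0_reCK // exprn_ge0. Qed.

Lemma overlap_ge0 n (A B : 'M[C]_n) i j : 0 <= overlap A B i j.
Proof. by apply: reC_ge0; rewrite exprn_ge0. Qed.

Lemma tr_mfun2 n (A B : 'M[C]_n) f g :
  reC (\tr (mfun f A *m mfun g B)) =
  \sum_i \sum_j f (eigval A i) * g (eigval B j) * overlap A B i j.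
Proof.
rewrite !mfunE; set P := eigvec A; set Q := eigvec B.
pose W := P *m dag Q.
rewrite -!mulmxA mxtrace_mulC !mulmxA.
rewrite -(mulmxA _ P) -(mulmxA _ Q) -[Q *m dag P]dagK dagM dagK -/W.
rewrite /mxtrace reC_sum; apply: eq_bigr => i _.
rewrite mxE reC_sum; apply: eq_bigr => j _.
rewrite mul_mx_rdiag mul_rdiag_mx dagE /= mulrAC -!mulrA.
by rewrite reCZ mulrA -normCK -overlapE reCZ reC_real [overlap _ _ _ _ * _]mulrC.
Qed.

End FunctionalCalculus.

(** * Klein's inequality and pinching *)

Section Pinching.
Variable R : realType.
Local Notation C := R[i].

(** The tangent bound ln x <= x - 1 at x = b / a, multiplied by a. For a = 0, where [log2] takes its
    default value 0, the claim is 0 <= b / ln 2. *)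
Lemma mul_log2_ge (a b : R) : 0 <= a -> 0 < b ->
  a * log2 b <= a * log2 a - (a - b) / ln 2.
Proof.
move=> a0 b0; have l2 : 0 < ln (2 : R) by rewrite ln_gt0 // ltr1n.
rewrite /log2 b0; case: ltP => [ap|an]; last first.
  have -> : a = 0 by apply/eqP; rewrite eq_le an a0.
  by rewrite !mul0r !sub0r mulNr opprK divr_ge0 // ltW.
have h : ln b - ln a <= b / a - 1.
  rewrite -ln_div ?posrE //; have := @le_ln1Dx R (b / a - 1).
  by rewrite [1 + _]addrC subrK; apply; rewrite ltrBrDr addNr divr_gt0.
have {}h : a * (ln b - ln a) <= b - a.
  by apply: le_trans (ler_wpM2l a0 h) _; rewrite mulrBr mulrC divfK ?gt_eqF // mulr1.
by rewrite !mulrA -mulrBl ler_pM2r ?invr_gt0 //; lra.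
Qed.

(* In the two eigenbases all four traces are sums weighted by the overlaps, so that the claim
   holds term by term, with no need for the overlaps to be doubly stochastic. *)
Lemma klein n (A B : 'M[C]_n) : psd A -> psd B ->
  reC (\tr A) = reC (\tr B) -> supp_le A B ->
  reC (\tr (A *m mfun (@log2 R) B)) <= reC (\tr (A *m mfun (@log2 R) A)).
Proof.
move=> pA pB trAB sAB; have [hA _] := pA; have [hB _] := pB.
(* The support condition: an eigenvector of [B] for the eigenvalue 0 is annihilated by [A], hence
   orthogonal to every eigenvector of [A] with nonzero eigenvalue. *)
have q0 i j : eigval B j = 0 -> eigval A i * overlap A B i j = 0.
  move=> b0; pose v := dag (eigvec B) *m delta_mx j 0 : 'cV[C]_n.
  have Bv : B *m v = 0.
    rewrite {1}(spectral_decomp hB) -!mulmxA (mulmxA (eigvec B)) eigvec_dagr mul1mx.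
    rewrite (_ : rdiag _ *m _ = 0) ?mulmx0 //; apply/matrixP => k l.
    by rewrite mul_rdiag_mx !mxE; case: eqP => [->|_]; rewrite ?b0 ?mul0r ?mulr0.
  have := sAB v Bv.
  rewrite {1}(spectral_decomp hA) => /(congr1 (mulmx (eigvec A))).
  rewrite !mulmxA eigvec_dagr mul1mx mulmx0 => /matrixP /(_ i 0).
  rewrite -!mulmxA mul_rdiag_mx mulmxA -colE !mxE => /eqP.
  rewrite mulf_eq0 => /orP[/eqP/complexI -> | /eqP W0]; first by rewrite mul0r.
  rewrite /overlap (_ : (_ *m _) i j = 0) ?normr0 ?expr0n ?mulr0 // -W0 mxE.
  by apply: eq_bigr => k _; rewrite mxE.
have trE f g : reC (\tr (mfun f A *m mfun g B)) =
    \sum_i \sum_j f (eigval A i) * g (eigval B j) * overlap A B i j.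
  exact: tr_mfun2.
have trA f : reC (\tr (mfun f A)) = \sum_i \sum_j f (eigval A i) * overlap A B i j.
  have := trE f (fun=> 1); rewrite mfun_cst1 mulmx1 => ->.
  by apply: eq_bigr => i _; apply: eq_bigr => j _; rewrite mulr1.
have trB g : reC (\tr (mfun g B)) = \sum_i \sum_j g (eigval B j) * overlap A B i j.
  have := trE (fun=> 1) g; rewrite mfun_cst1 mul1mx => ->.
  by apply: eq_bigr => i _; apply: eq_bigr => j _; rewrite mul1r.
have tA := trA id; rewrite (mfun_id hA) in tA.
have tB := trB id; rewrite (mfun_id hB) in tB.
have tAB := trE id (@log2 R); rewrite (mfun_id hA) in tAB.
have tAA := trA (fun x => id x * log2 x); rewrite -mfunM (mfun_id hA) in tAA.
(* The added trace difference is zero, but it supplies the linear term that makes each summand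
   nonnegative by [mul_log2_ge]. *)
suff : 0 <= reC (\tr (A *m mfun (@log2 R) A)) - reC (\tr (A *m mfun (@log2 R) B))
    - (reC (\tr A) - reC (\tr B)) / ln 2.
  by rewrite trAB subrr mul0r subr0 subr_ge0.
rewrite tAB tAA tA tB -!sumrB mulr_suml -sumrB.
apply: sumr_ge0 => i _; rewrite -!sumrB mulr_suml -sumrB; apply: sumr_ge0 => j _ /=.
have := overlap_ge0 A B i j; have := q0 i j; set q := overlap _ _ _ _.
have := eigval_ge0 i pA; have := eigval_ge0 j pB.
set a := eigval A i; set b := eigval B j => b0 a0 aq q_ge0.
have [b00|bp] := eqVneq b 0.
  have {}aq := aq b00; rewrite b00 mulrAC aq [a * log2 0 * q]mulrAC aq.
  by rewrite !mul0r !subr0 mul0r.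
have bp' : 0 < b by rewrite lt_def bp.
by have := ler_wpM2r q_ge0 (mul_log2_ge a0 bp'); lra.
Qed.

Lemma vN_entropyE n (A : 'M[C]_n) : vN_entropy A = - reC (\tr (A *m mfun (@log2 R) A)).
Proof. by rewrite /vN_entropy mxfun_mfun. Qed.

(** * Pinching by a complete family of orthogonal projectors *)

Section Pinch.
Variables (n N : nat) (P : 'I_N -> 'M[C]_n).
Hypothesis hP : type_of_info P.

(** The projectors act on the whole space here; [dephase Z] is convertible to the case of the
    projectors [tensmx (Z j) 1]. *)
Definition pinch (X : 'M[C]_n) : 'M[C]_n := \sum_j P j *m X *m P j.

Let Pherm j : dag (P j) = P j. Proof. by have [h _ _] := hP; exact: h. Qed.
Let Porth j k : P j *m P k = if j == k then P j else 0.
Proof. by have [_ h _] := hP; exact: h. Qed.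
Let Psum : \sum_j P j = 1%:M. Proof. by have [_ _ h] := hP. Qed.

Lemma mul_proj_pinch X k : P k *m pinch X = P k *m X *m P k.
Proof.
rewrite /pinch mulmx_sumr (bigD1 k) //= big1 => [|j jk]; last first.
  by rewrite !mulmxA Porth eq_sym (negPf jk) !mul0mx.
by rewrite addr0 !mulmxA Porth eqxx.
Qed.

Lemma mul_pinch_proj X k : pinch X *m P k = P k *m X *m P k.
Proof.
rewrite /pinch mulmx_suml (bigD1 k) //= big1 => [|j jk]; last first.
  by rewrite -mulmxA Porth (negPf jk) mulmx0.
by rewrite addr0 -!mulmxA Porth eqxx.
Qed.

Lemma pinch_id X : (forall k, P k *m X = X *m P k) -> pinch X = X.
Proof.
move=> h; rewrite -[RHS]mulmx1 -Psum mulmx_sumr; apply: eq_bigr => k _.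
by rewrite h -mulmxA Porth eqxx.
Qed.

Lemma pinch_idem X : pinch (pinch X) = pinch X.
Proof. by apply: pinch_id => k; rewrite mul_proj_pinch mul_pinch_proj. Qed.

Lemma tr_pinch X : \tr (pinch X) = \tr X.
Proof.
rewrite -[in RHS](mulmx1 X) -Psum mulmx_sumr /pinch !raddf_sum; apply: eq_bigr => k _ /=.
by rewrite mxtrace_mulC mulmxA Porth eqxx mxtrace_mulC.
Qed.

(** Together with [pinch_idem], this makes pinching a self-adjoint projection for the trace pairing,
    onto the matrices commuting with every [P k]. *)
Lemma tr_mul_pinch X Y : \tr (X *m pinch Y) = \tr (pinch X *m Y).
Proof.
rewrite /pinch mulmx_sumr mulmx_suml !raddf_sum; apply: eq_bigr => k _ /=.
by rewrite !mulmxA mxtrace_mulC !mulmxA.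
Qed.

Lemma tr_pinch_mul_pinch X Y : \tr (pinch X *m pinch Y) = \tr (X *m pinch Y).
Proof. by rewrite -tr_mul_pinch pinch_idem. Qed.

Lemma psd_pinch X : psd X -> psd (pinch X).
Proof. by move=> pX; apply: psd_sum => k; rewrite -{1}Pherm; exact: psd_congr. Qed.

Lemma density_pinch X : density X -> density (pinch X).
Proof. by move=> [pX tX]; split; [exact: psd_pinch | rewrite tr_pinch]. Qed.

Lemma pinch_mfun f X : psd X -> pinch (mfun f (pinch X)) = mfun f (pinch X).
Proof.
move=> /psd_pinch[hX _]; apply: pinch_id => k; apply/esym/mfun_intertwine => //.
by rewrite mul_proj_pinch mul_pinch_proj.
Qed.

(** Each [P k] commutes with [pinch Y] and so preserves its kernel. *)
Lemma supp_le_pinch2 X Y : supp_le X (pinch Y) -> supp_le (pinch X) (pinch Y).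
Proof.
move=> h v Yv; rewrite /pinch mulmx_suml big1 // => k _.
by rewrite -!mulmxA h ?mulmx0 // mulmxA mul_pinch_proj -mul_proj_pinch -mulmxA Yv mulmx0.
Qed.

(** If [pinch X] kills [v], then so does each [P k *m X *m P k], whence the square root of [X] kills
    [P k *m v]; summing over k gives [X *m v = 0]. Thus the relative entropy is finite at the
    minimiser. *)
Lemma supp_le_pinch X : psd X -> supp_le X (pinch X).
Proof.
move=> pX v Xv; set S := mfun Num.sqrt X.
have hS' : dag S = S by exact: mfun_herm.
have SP k : S *m P k *m v = 0.
  apply: dag_mul_eq0; rewrite !dagM Pherm hS' -!mulmxA (mulmxA S) sqrt_psd_sqr //.
  have e : P k *m (X *m (P k *m v)) = 0.
    by rewrite !mulmxA -mul_proj_pinch -mulmxA Xv mulmx0.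
  by rewrite e mulmx0.
rewrite -[v]mul1mx -Psum mulmx_suml mulmx_sumr big1 // => k _.
by rewrite -(sqrt_psd_sqr pX) -mulmxA [_ *m (P k *m v)]mulmxA SP mulmx0.
Qed.

Lemma rel_entropy_pinch_ge X Y : density X -> density Y ->
  ((vN_entropy (pinch X) - vN_entropy X)%:E <= rel_entropy X (pinch Y))%E.
Proof.
move=> [pX tX] [pY tY]; rewrite /rel_entropy; case: asboolP => [sXY|_]; last exact: leey.
rewrite lee_fin [leRHS]addrC lerD2r [in leLHS]vN_entropyE mxfun_mfun lerN2.
(* The logarithm of [pinch Y] is itself pinched, so the pinching passes to [X], and Klein's
   inequality compares the two pinched states. *)
rewrite -(pinch_mfun _ pY) tr_mul_pinch.
apply: klein; [exact: psd_pinch|exact: psd_pinch| |exact: supp_le_pinch2].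
by rewrite !tr_pinch tX tY.
Qed.

Lemma rel_entropy_pinch X : psd X ->
  (rel_entropy X (pinch X) = (vN_entropy (pinch X) - vN_entropy X)%:E)%E.
Proof.
move=> pX; rewrite /rel_entropy asboolT; last exact: supp_le_pinch.
rewrite addrC [in RHS]vN_entropyE mxfun_mfun -(pinch_mfun _ pX) tr_mul_pinch.
by rewrite pinch_mfun.
Qed.

(** Pythagoras for the projection [pinch]: the squared distances of [X] and of [pinch X] to
    [pinch Y] have the same cross term. *)
Lemma D_HS_pinch X Y : D_HS X (pinch Y) = reC (\tr (X *m X)) - reC (\tr (pinch X *m pinch X))
  + D_HS (pinch X) (pinch Y).
Proof.
have trB (A B : 'M[C]_n) : \tr (A - B) = \tr A - \tr B by exact: raddfB.
have e A : reC (\tr ((A - pinch Y) *m (A - pinch Y))) =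
   reC (\tr (A *m A)) - 2 * reC (\tr (A *m pinch Y)) + reC (\tr (pinch Y *m pinch Y)).
  rewrite mulmxBl !mulmxBr !trB !reCB [\tr (pinch Y *m A)]mxtrace_mulC.
  by lra.
rewrite /D_HS !e (tr_pinch_mul_pinch X Y).
move: (reC _) (reC _) (reC _) (reC _) => a b c d; lra.
Qed.

End Pinch.
End Pinching.

(** * Fidelity with a pinched state *)

Section Guessing.
Variable R : realType.
Local Notation C := R[i].
Local Notation rC := (real_complex R).

Lemma tr_mfun n f (A : 'M[C]_n) : reC (\tr (mfun f A)) = \sum_i f (eigval A i).
Proof.
rewrite mfunE mxtrace_mulC mulmxA eigvec_dagr mul1mx /mxtrace reC_sum.
by apply: eq_bigr => i _; rewrite rdiagE eqxx mulr1n reC_real.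
Qed.

Lemma mfunD n f g (A : 'M[C]_n) : mfun f A + mfun g A = mfun (fun x => f x + g x) A.
Proof.
rewrite !mfunE -mulmxDl -mulmxDr; congr (_ *m _ *m _).
by apply/matrixP => i j; rewrite mxE !rdiagE -mulrnDl -rmorphD.
Qed.

Lemma diag_gram_ge0 m n (X : 'M[C]_(m, n)) k : 0 <= (dag X *m X) k k.
Proof.
by rewrite mxE; apply: sumr_ge0 => i _; rewrite dagE mulrC -normCK exprn_ge0.
Qed.

Lemma psd_tr_ge0 n (A : 'M[C]_n) : psd A -> 0 <= reC (\tr A).
Proof.
move=> pA; have [hA _] := pA.
rewrite -(mfun_id hA) tr_mfun; apply: sumr_ge0 => i _; exact: eigval_ge0.
Qed.

(* Columnwise Cauchy-Schwarz in an eigenbasis of the Gram matrix: this is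
   Re <E, A> <= ||A||_1 for an isometry E. *)
Lemma tr_isometry_le_sqrt (I : finType) p m (E A : I -> 'M[C]_(p, m)) :
  \sum_j dag (E j) *m E j = 1%:M ->
  \sum_j reC (\tr (dag (E j) *m A j)) <=
  reC (\tr (mfun Num.sqrt (\sum_j dag (A j) *m A j))).
Proof.
move=> E1; set H := \sum_j dag (A j) *m A j.
have [hH _] : psd H by apply: psd_sum => j; exact: psd_gram.
(* In the eigenbasis of [H], the k-th columns of the [E' j], stacked over j, form a unit vector, and
   those of the [A' j] a vector of squared norm [eigval H k]. The real part of their inner product
   is [s k]. *)
set V := eigvec H; pose E' j := E j *m dag V; pose A' j := A j *m dag V.
have gE : \sum_j dag (E' j) *m E' j = 1%:M.
  transitivity (V *m (\sum_j dag (E j) *m E j) *m dag V).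
    rewrite mulmx_sumr mulmx_suml; apply: eq_bigr => j _.
    by rewrite dagM dagK !mulmxA.
  by rewrite E1 mulmx1 eigvec_dagr.
have gA : \sum_j dag (A' j) *m A' j = rdiag (eigval H).
  transitivity (V *m H *m dag V).
    rewrite mulmx_sumr mulmx_suml; apply: eq_bigr => j _.
    by rewrite dagM dagK !mulmxA.
  rewrite [X in _ *m X *m _](spectral_decomp hH) !mulmxA eigvec_dagr mul1mx.
  by rewrite -mulmxA eigvec_dagr mulmx1.
pose s k := \sum_j reC ((dag (E' j) *m A' j) k k).
have -> : \sum_j reC (\tr (dag (E j) *m A j)) = \sum_k s k.
  rewrite exchange_big; apply: eq_bigr => j _.
  have -> : \tr (dag (E j) *m A j) = \tr (dag (E' j) *m A' j).
    by rewrite dagM dagK -mulmxA [RHS]mxtrace_mulC -!mulmxA eigvec_dagl mulmx1.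
  by rewrite /mxtrace reC_sum.
rewrite tr_mfun; apply: ler_sum => k _.
suff h : s k ^+ 2 <= eigval H k.
  by apply: le_trans (ler_norm _) _; rewrite -sqrtr_sqr ler_wsqrtr.
have : 0 <= \sum_j reC ((dag (A' j - rC (s k) *: E' j) *m (A' j - rC (s k) *: E' j)) k k).
  by apply: sumr_ge0 => j _; apply/reC_ge0/diag_gram_ge0.
have e j : reC ((dag (A' j - rC (s k) *: E' j) *m (A' j - rC (s k) *: E' j)) k k) =
    reC ((dag (A' j) *m A' j) k k) - 2 * s k * reC ((dag (E' j) *m A' j) k k)
    + s k ^+ 2 * reC ((dag (E' j) *m E' j) k k).
  have c : reC ((dag (A' j) *m E' j) k k) = reC ((dag (E' j) *m A' j) k k).
    by rewrite -[RHS]reC_conj -dagE dagM dagK.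
  move: c; rewrite dagB dagZ conj_real mulmxBl !mulmxBr -!scalemxAl -!scalemxAr.
  have ent (X Y Z T : 'M[C]_m) (t : R) :
    reC ((X - rC t *: Y - (rC t *: Z - rC t *: (rC t *: T))) k k) =
    reC (X k k) - t * reC (Y k k) - (t * reC (Z k k) - t * (t * reC (T k k))).
    by rewrite !mxE !(reCD, reCN) !reCZ.
  rewrite ent => ->.
  by move: (reC _) (reC _) (reC _) => a b d; lra.
rewrite (eq_bigr _ (fun j _ => e j)) big_split /= sumrB -!mulr_sumr.
rewrite -!reC_sum -!summxE gA gE !mxE eqxx !mulr1n.
rewrite reC_real (_ : reC 1 = 1) // summxE reC_sum -/(s k).
by lra.
Qed.

(** With K and S the square roots of [M *m dag M] and [T], both (S K)(S K)^* and (S M)(S M)^* equal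
    S M M^* S. Two uses of [tr_mfun_gram] replace K by M, so any factor of the state computes the
    fidelity. *)
Lemma fidelity_gram n m (M : 'M[C]_(n, m)) (T : 'M[C]_n) : psd T ->
  fidelity (M *m dag M) T = reC (\tr (mfun Num.sqrt (dag M *m T *m M))) ^+ 2.
Proof.
move=> pT; rewrite /fidelity !mxfun_mfun; congr (reC _ ^+ 2).
have pMM : psd (M *m dag M) by rewrite -{1}[M]dagK; exact: psd_gram.
set K := mfun Num.sqrt (M *m dag M); set S := mfun Num.sqrt T.
have hK : dag K = K by exact: mfun_herm.
have hS : dag S = S by exact: mfun_herm.
rewrite -(sqrt_psd_sqr pT) -/S.
transitivity (\tr (mfun Num.sqrt (dag (S *m K) *m (S *m K)))).
  by rewrite dagM hK hS !mulmxA.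
rewrite -tr_mfun_gram ?sqrtr0 //.
transitivity (\tr (mfun Num.sqrt ((S *m M) *m dag (S *m M)))).
  by rewrite !dagM hK hS !mulmxA -(mulmxA S) sqrt_psd_sqr // !mulmxA.
by rewrite tr_mfun_gram ?sqrtr0 // dagM hS !mulmxA.
Qed.

Section Guess.
Variables (n m N : nat) (P : 'I_N -> 'M[C]_n) (M : 'M[C]_(n, m)).
Hypothesis hP : type_of_info P.

Let Pherm j : dag (P j) = P j. Proof. by have [h _ _] := hP; exact: h. Qed.
Let Porth j k : P j *m P k = if j == k then P j else 0.
Proof. by have [_ h _] := hP; exact: h. Qed.

(** For [M] the amplitude operator of the pure state, this is the transpose of p_j rho_(C,j). *)
Let W j := dag M *m P j *m M.

(** Orthogonality of the projectors removes the cross terms of [dag L *m L]; the guessing value of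
    the family E_j^* E_j becomes a squared Hilbert-Schmidt norm. *)
Lemma gram_sum_proj p (E : 'I_N -> 'M[C]_(p, m)) :
  let L := \sum_j P j *m M *m dag (E j) in
  \tr (dag L *m L) = \sum_j \tr (dag (E j) *m E j *m W j).
Proof.
move=> L; rewrite /L dag_sum mulmx_suml raddf_sum; apply: eq_bigr => j _ /=.
rewrite mulmx_sumr (bigD1 j) //= big1 => [|k kj]; last first.
  rewrite !dagM dagK Pherm !mulmxA -(mulmxA _ (P j) (P k)) Porth eq_sym (negPf kj).
  by rewrite mulmx0 !mul0mx.
rewrite addr0 !dagM dagK Pherm !mulmxA -(mulmxA _ (P j) (P j)) Porth eqxx.
by rewrite mxtrace_mulC !mulmxA.
Qed.

Lemma fidelity_pinch_le (j0 : 'I_N) (s : 'M[C]_n) : density s ->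
  exists2 Q : 'I_N -> 'M[C]_m, povm Q &
    fidelity (M *m dag M) (pinch P s) <= reC (\sum_j \tr (Q j *m W j)).
Proof.
move=> [ps ts]; have pps := psd_pinch hP ps.
rewrite fidelity_gram //; set H := dag M *m _ *m M.
have pH : psd H by exact: psd_congr.
have [hH _] := pH.
set S := mfun Num.sqrt s; have hS : dag S = S by exact: mfun_herm.
pose B j := S *m P j *m M.
have HB : \sum_j dag (B j) *m B j = H.
  rewrite /H /pinch mulmx_sumr mulmx_suml; apply: eq_bigr => j _.
  by rewrite !dagM hS Pherm !mulmxA -(mulmxA _ S S) sqrt_psd_sqr // !mulmxA.
(* As the inverse of 0 is 0, this is the pseudo-inverse of the square root of [H]. *)
set G := mfun (fun x => (Num.sqrt x)^-1) H; have hG : dag G = G by exact: mfun_herm.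
pose E j := B j *m G.
pose f x : R := (Num.sqrt x)^-1 * x * (Num.sqrt x)^-1.
have EE : \sum_j dag (E j) *m E j = mfun f H.
  transitivity (G *m H *m G).
    rewrite -HB mulmx_sumr mulmx_suml; apply: eq_bigr => j _.
    by rewrite dagM hG !mulmxA.
  by rewrite -[X in G *m X *m G](mfun_id hH) /G !mfunM.
(* Hence the E_j^* E_j add up to the projector onto the support of [H], and [D] below is the
   projector onto its kernel. *)
have f01 i : f (eigval H i) = (eigval H i != 0)%:R.
  have e0 := eigval_ge0 i pH; rewrite /f.
  have [->|ep] := eqVneq (eigval H i) 0; first by rewrite mulr0 mul0r.
  rewrite -{2}(sqr_sqrtr e0) expr2 mulrA mulVf ?mul1r ?divff //.
    by rewrite sqrtr_eq0 -ltNge lt_def ep.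
  by rewrite sqrtr_eq0 -ltNge lt_def ep.
pose D := mfun (fun x => 1 - f x) H.
have pD : psd D.
  by apply: psd_mfun => i; rewrite f01; case: (_ != _); rewrite ?subrr ?subr0.
(* The missing part [D] goes to the single outcome [j0]; this can only raise the guessing value,
   since [D] and [W j0] are positive. *)
exists (fun j => dag (E j) *m E j + (if j == j0 then D else 0)).
  split=> [j|].
    by apply: psdD; [exact: psd_gram | case: (j == j0); [exact: pD | exact: psd0]].
  rewrite big_split /= EE -big_mkcond big_pred1_eq mfunD -[RHS](mfun_cst1 H).
  by apply: eq_mfun => i; rewrite addrC subrK.
have pW j : psd (W j).
  apply: psd_congr; rewrite -[P j](pinch_id hP); last first.
    by move=> k; rewrite !Porth eq_sym; case: eqP => [->|].
  by apply: (psd_pinch hP); have := psd_gram (P j); rewrite Pherm Porth eqxx.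
apply: (@le_trans _ _ (reC (\sum_j \tr (dag (E j) *m E j *m W j)))); last first.
  rewrite !reC_sum; apply: ler_sum => j _.
  rewrite mulmxDl mxtraceD reCD lerDl; case: eqP => _; last by rewrite mul0mx mxtrace0.
  rewrite -(sqrt_psd_sqr pD) -mulmxA mxtrace_mulC; apply: psd_tr_ge0.
  by have := psd_congr (mfun Num.sqrt D) (pW j); rewrite (mfun_herm Num.sqrt D).
rewrite -(gram_sum_proj E); set L := \sum_j _.
have SS : reC (\tr (dag S *m S)) = 1 by rewrite hS sqrt_psd_sqr // ts.
(* [S] has unit Hilbert-Schmidt norm because [s] has trace 1; its inner product with [L] turns out
   to be the trace of H G, that is, of the square root of [H]. *)
apply: le_trans (tr_cauchy_schwarz L SS).
suff -> : reC (\tr (mfun Num.sqrt H)) = reC (\tr (dag S *m L)) by [].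
have -> : mfun Num.sqrt H = H *m G.
  rewrite -[X in X *m G](mfun_id hH) /G mfunM; apply: eq_mfun => i.
  have e0 := eigval_ge0 i pH.
  have [->|ep] := eqVneq (eigval H i) 0; first by rewrite sqrtr0 mul0r.
  rewrite -{2}(sqr_sqrtr e0) expr2 mulfK // sqrtr_eq0 -ltNge lt_def ep //.
rewrite -reC_conj -tr_dag dagM hG hH -{1}HB mulmx_sumr /L mulmx_sumr !raddf_sum.
congr reC; apply: eq_bigr => j _ /=.
by rewrite hS [in RHS]mulmxA [RHS]mxtrace_mulC [S *m (P j *m M)]mulmxA /E dagM hG mulmxA.
Qed.

Lemma fidelity_pinch_ge (Q : 'I_N -> 'M[C]_m) : \tr (dag M *m M) = 1 -> povm Q ->
  exists2 s : 'M[C]_n, density s &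
    reC (\sum_j \tr (Q j *m W j)) <= fidelity (M *m dag M) (pinch P s).
Proof.
move=> trM [pQ Q1]; pose S j := mfun Num.sqrt (Q j).
have hS j : dag (S j) = S j by exact: mfun_herm.
have SS j : S j *m S j = Q j by exact: sqrt_psd_sqr.
pose L := \sum_j P j *m M *m dag (S j).
have gL : \tr (dag L *m L) = \sum_j \tr (Q j *m W j).
  by rewrite gram_sum_proj; apply: eq_bigr => j _; rewrite hS SS.
have g0 := tr_dag_mul_ge0 L; rewrite -gL; set g := reC _.
have rg : rC g = \tr (dag L *m L) by rewrite ge0_reCK.
(* For a zero value any state serves, since the fidelity is a square; otherwise g normalises
   [L *m dag L]. *)
have [g_le0|g_gt0] := leP g 0.
  exists (M *m dag M); last by apply: le_trans g_le0 _; exact: sqr_ge0.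
  by split; [rewrite -{1}[M]dagK; exact: psd_gram | rewrite mxtrace_mulC].
pose s := rC g^-1 *: (L *m dag L).
have ds : density s.
  split; last by rewrite mxtraceZ mxtrace_mulC -rg -rmorphM mulVf ?gt_eqF.
  apply: psdZ; first by rewrite ler0c invr_ge0 ltW.
  by rewrite -{1}[L]dagK; exact: psd_gram.
exists s => //; have [ps _] := ds.
rewrite fidelity_gram; last exact: psd_pinch.
(* Chosen so that the [A j] have total Gram matrix M^* (pinch s) M while pairing with the isometric
   family [S j] to r g, whose square is g. *)
pose r := Num.sqrt g^-1; pose A j := rC r *: (S j *m W j).
have hW j : dag (W j) = W j by rewrite !dagM dagK Pherm mulmxA.
have PL k : P k *m L = P k *m M *m S k.
  rewrite mulmx_sumr (bigD1 k) //= big1 => [|j jk]; last first.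
    by rewrite !mulmxA Porth eq_sym (negPf jk) !mul0mx.
  by rewrite addr0 !mulmxA Porth eqxx hS.
have -> : dag M *m pinch P s *m M = \sum_j dag (A j) *m A j.
  rewrite mulmx_sumr mulmx_suml; apply: eq_bigr => j _.
  transitivity (rC g^-1 *: (dag (S j *m W j) *m (S j *m W j))); last first.
    rewrite /A dagZ conj_real -scalemxAl -scalemxAr scalerA -rmorphM -expr2 sqr_sqrtr //.
    by rewrite invr_ge0 ltW.
  rewrite /s -!(scalemxAl, scalemxAr); congr (_ *: _).
  have -> : P j *m (L *m dag L) *m P j = (P j *m L) *m dag (P j *m L).
    by rewrite dagM Pherm !mulmxA.
  by rewrite PL [dag (S j *m W j)]dagM hS hW !dagM hS Pherm !mulmxA.
have S1 : \sum_j dag (S j) *m S j = 1%:M.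
  by rewrite -Q1; apply: eq_bigr => j _; rewrite hS SS.
have := tr_isometry_le_sqrt A S1.
have -> : \sum_j reC (\tr (dag (S j) *m A j)) = r * g.
  rewrite /g gL reC_sum mulr_sumr; apply: eq_bigr => j _.
  by rewrite hS -scalemxAr mxtraceZ reCZ mulmxA SS.
move=> h; have rg0 : 0 <= r * g by rewrite mulr_ge0 ?sqrtr_ge0 // ltW.
have -> : g = (r * g) ^+ 2.
  by rewrite exprMn sqr_sqrtr ?invr_ge0 ?ltW // expr2 mulrA mulVf ?mul1r ?gt_eqF.
by rewrite ler_pXn2r ?nnegrE //; exact: le_trans h.
Qed.

End Guess.
End Guessing.

(** * Existence of an optimal POVM *)

Section OptimalPovm.
Variable R : realType.
Local Notation C := R[i].
Local Notation rC := (real_complex R).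

(** * Continuity of complex-valued and matrix-valued maps *)

Section Continuity.
Variable T : topologicalType.

(** Continuity is stated through the two real components, so that only limits of real functions
    occur. *)
Definition ccont (f : T -> C) :=
  continuous (fun v => complex.Re (f v) : R) /\ continuous (fun v => complex.Im (f v) : R).

Lemma eq_ccont f g : f =1 g -> ccont f -> ccont g.
Proof. by move=> /funext ->. Qed.

Lemma ccont_cst c : ccont (fun=> c).
Proof. by split=> x; apply: cvg_cst. Qed.

Lemma ccontD f g : ccont f -> ccont g -> ccont (fun v => f v + g v).
Proof.
move=> [f1 f2] [g1 g2]; split=> x.
  rewrite (_ : (fun v => _) = (fun v => complex.Re (f v) + complex.Re (g v))).
    by apply: cvgD; [exact: f1 | exact: g1].
  by apply/funext => v; case: (f v) (g v) => [a b] [c d].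
rewrite (_ : (fun v => _) = (fun v => complex.Im (f v) + complex.Im (g v))).
  by apply: cvgD; [exact: f2 | exact: g2].
by apply/funext => v; case: (f v) (g v) => [a b] [c d].
Qed.

Lemma ccontM f g : ccont f -> ccont g -> ccont (fun v => f v * g v).
Proof.
move=> [f1 f2] [g1 g2]; split=> x.
  rewrite (_ : (fun v => _) = (fun v => complex.Re (f v) * complex.Re (g v)
                                       - complex.Im (f v) * complex.Im (g v))).
    apply: cvgB; apply: cvgM; [exact: f1|exact: g1|exact: f2|exact: g2].
  by apply/funext => v; case: (f v) (g v) => [a b] [c d].
rewrite (_ : (fun v => _) = (fun v => complex.Re (f v) * complex.Im (g v)
                                     + complex.Im (f v) * complex.Re (g v))).
  apply: cvgD; apply: cvgM; [exact: f1|exact: g2|exact: f2|exact: g1].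
by apply/funext => v; case: (f v) (g v) => [a b] [c d].
Qed.

Lemma ccont_conj f : ccont f -> ccont (fun v => (f v)^*).
Proof.
move=> [f1 f2]; split=> x.
  rewrite (_ : (fun v => _) = (fun v => complex.Re (f v))); first exact: f1.
  by apply/funext => v; case: (f v).
rewrite (_ : (fun v => _) = (fun v => - complex.Im (f v))); first by apply: cvgN; exact: f2.
by apply/funext => v; case: (f v).
Qed.

Lemma ccont_sum (I : finType) (f : I -> T -> C) :
  (forall i, ccont (f i)) -> ccont (fun v => \sum_i f i v).
Proof.
move=> h; rewrite /index_enum; elim: (X in bigop _ X) => [|i r IHr].
  by apply: eq_ccont (ccont_cst 0) => v; rewrite big_nil.
by apply: eq_ccont (ccontD (h i) IHr) => v; rewrite big_cons.
Qed.

Definition mcont m n (X : T -> 'M[C]_(m, n)) := forall i j, ccont (fun v => X v i j).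

Lemma mcont_cst m n (A : 'M[C]_(m, n)) : mcont (fun=> A).
Proof. by move=> i j; exact: ccont_cst. Qed.

Lemma mcontM m n p (X : T -> 'M[C]_(m, n)) (Y : T -> 'M[C]_(n, p)) :
  mcont X -> mcont Y -> mcont (fun v => X v *m Y v).
Proof.
move=> cX cY i j; apply: (@eq_ccont (fun v => \sum_k X v i k * Y v k j)).
  by move=> v; rewrite mxE.
by apply: ccont_sum => k; exact: ccontM.
Qed.

Lemma mcontD m n (X Y : T -> 'M[C]_(m, n)) :
  mcont X -> mcont Y -> mcont (fun v => X v + Y v).
Proof.
move=> cX cY i j; apply: (@eq_ccont (fun v => X v i j + Y v i j)).
  by move=> v; rewrite mxE.
exact: ccontD.
Qed.

Lemma mcont_dag m n (X : T -> 'M[C]_(m, n)) : mcont X -> mcont (fun v => dag (X v)).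
Proof.
move=> cX i j; apply: (@eq_ccont (fun v => (X v j i)^*)); last exact: ccont_conj.
by move=> v; rewrite dagE.
Qed.

Lemma mcont_sum (I : finType) m n (X : I -> T -> 'M[C]_(m, n)) :
  (forall i, mcont (X i)) -> mcont (fun v => \sum_i X i v).
Proof.
move=> h i j; apply: (@eq_ccont (fun v => \sum_k X k v i j)).
  by move=> v; rewrite summxE.
by apply: ccont_sum => k; exact: h.
Qed.

Lemma ccont_tr n (X : T -> 'M[C]_n) : mcont X -> ccont (fun v => \tr (X v)).
Proof. by move=> h; apply: ccont_sum => k; exact: h. Qed.

Lemma continuous_reC f : ccont f -> continuous (fun v => reC (f v) : R).
Proof. by case. Qed.

End Continuity.

(** Writing the effects as E_j^* E_j makes positivity automatic and leaves one polynomial constraint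
    on the real coordinates of the E_j. Its solution set is compact, so the continuous value attains
    its maximum there. *)
Lemma optimal_povm N m (W : 'I_N -> 'M[C]_m) : (0 < N)%N ->
  exists2 Q : 'I_N -> 'M[C]_m, povm Q &
    forall Q' : 'I_N -> 'M[C]_m, povm Q' ->
      reC (\sum_j \tr (Q' j *m W j)) <= reC (\sum_j \tr (Q j *m W j)).
Proof.
move=> N0; pose j0 := Ordinal N0.
pose I := ('I_N * 'I_m * 'I_m * bool)%type.
pose V := 'rV[R]_#|{: I}|.
pose E (v : V) (j : 'I_N) : 'M[C]_m := \matrix_(k, l)
  (v 0 (enum_rank ((j, k, l, true) : I)) +i* v 0 (enum_rank ((j, k, l, false) : I)))%C.
pose gram v := \sum_j dag (E v j) *m E v j.
pose F v := reC (\sum_j \tr (dag (E v j) *m E v j *m W j)).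
have EK (E' : 'I_N -> 'M[C]_m) : exists v, forall j, E v j = E' j.
  exists (\row_k let: (j, a, b, t) := enum_val k in
    if t then complex.Re (E' j a b) else complex.Im (E' j a b)) => j.
  by apply/matrixP => a b; rewrite !mxE !enum_rankK; case: (E' j a b).
have Ec j : mcont (fun v => E v j).
  move=> k l; split.
    rewrite (_ : (fun v => _) = (fun v : V => v 0 (enum_rank ((j, k, l, true) : I)))).
      exact: coord_continuous.
    by apply/funext => v; rewrite mxE.
  rewrite (_ : (fun v => _) = (fun v : V => v 0 (enum_rank ((j, k, l, false) : I)))).
    exact: coord_continuous.
  by apply/funext => v; rewrite mxE.
pose D v := gram v + - 1%:M.
pose phi v := reC (\tr (dag (D v) *m D v)).
have cgram : mcont gram.
  by apply: mcont_sum => j; apply: mcontM => //; exact: mcont_dag.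
have cphi : continuous phi.
  have cD : mcont D by apply: mcontD => //; exact: mcont_cst.
  by apply/continuous_reC/ccont_tr/mcontM => //; exact: mcont_dag.
have cF : continuous F.
  apply/continuous_reC/ccont_sum => j; apply/ccont_tr/mcontM; last exact: mcont_cst.
  by apply: mcontM => //; exact: mcont_dag.
pose A := [set v | gram v = 1%:M]%classic.
(* The POVM that always answers [j0]; for this, N must be positive. *)
have A0 : (A !=set0)%classic.
  have [v Ev] := EK (fun j => if j == j0 then 1%:M else 0).
  exists v; rewrite /A /= /gram (bigD1 j0) //= big1 => [|j jj0]; rewrite Ev.
    by rewrite eqxx dag1 mulmx1 addr0.
  by rewrite (negPf jj0) mulmx0.
have clA : closed A.
  (* The constraint is the vanishing of the squared Hilbert-Schmidt norm of [D], a single continuous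
     real function. *)
  have -> : A = (phi @^-1` [set x | x = 0])%classic.
    apply/seteqP; split=> v /=; rewrite /A /phi /D /=.
      by move=> ->; rewrite subrr mulmx0 mxtrace0.
    move=> h; apply/eqP; rewrite -subr_eq0; apply/eqP/tr_dag_mul_eq0.
    by rewrite -[LHS]ge0_reCK ?tr_dag_mul_ge0 // h.
  by apply: preimage_closed; [move=> x _; exact: cphi | exact: closed_eq].
(* A diagonal entry of [gram v] is the sum of the squares of all coordinates in one column of the
   E_j. As it equals 1, each coordinate lies in [-1, 1]. *)
have bA : (A `<=` [set v : V | forall i, `[(-1)%R, 1%R]%classic (v ord0 i)])%classic.
  move=> v; rewrite /A /= => gv i; rewrite -(enum_valK i).
  case: (enum_val i) => [[[j a] b] t] /=.
  have h1 : reC (gram v b b) = 1 by rewrite gv mxE eqxx.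
  have h2 : (v 0 (enum_rank ((j, a, b, true) : I))) ^+ 2
       + (v 0 (enum_rank ((j, a, b, false) : I))) ^+ 2 <= 1.
    have p k : 0 <= reC ((dag (E v k) *m E v k) b b) by exact/reC_ge0/diag_gram_ge0.
    rewrite -h1 summxE reC_sum (bigD1 j) //=.
    apply: (@le_trans _ _ (reC ((dag (E v j) *m E v j) b b))); last first.
      by rewrite lerDl sumr_ge0.
    rewrite mxE reC_sum (bigD1 a) //=.
    apply: (@le_trans _ _ (reC (dag (E v j) b a * E v j a b))).
      by rewrite dagE mxE /reC /= mulNr opprK -!expr2.
    rewrite lerDl sumr_ge0 // => k _; apply: reC_ge0.
    by rewrite dagE mulrC -normCK exprn_ge0.
  rewrite /= in_itv /= -ler_norml -(@ler_pXn2r _ 2) ?nnegrE // expr1n real_normK ?num_real //.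
  by apply: le_trans h2; case: t; rewrite ?lerDl ?lerDr sqr_ge0.
have coA : compact A.
  apply: subclosed_compact clA _ bA.
  by apply: (@rV_compact R _ (fun=> `[(-1)%R, 1%R]%classic)) => i; exact: segment_compact.
have [c cA cmax] := compact_EVT_max A0 coA (continuous_subspaceT cF).
exists (fun j => dag (E c j) *m E c j).
  by split=> [j|]; [exact: psd_gram | move: cA; rewrite inE].
move=> Q' [pQ' Q1]; have [v Ev] := EK (fun j => mfun Num.sqrt (Q' j)).
have QE j : dag (E v j) *m E v j = Q' j by rewrite Ev mfun_herm sqrt_psd_sqr.
have := cmax v; rewrite inE /A /= /gram /F.
rewrite (eq_bigr _ (fun j _ => QE j)) => /(_ Q1).
by rewrite (eq_bigr (fun j => \tr (Q' j *m W j))) // => j _; rewrite QE.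
Qed.

End OptimalPovm.

(** * Marginals of a tripartite pure state *)

Section Tripartite.
Variable R : realType.
Local Notation C := R[i].

Lemma sum_idx (U : nmodType) m n (F : 'I_(m * n) -> U) :
  \sum_k F k = \sum_i \sum_j F (idx (i, j)).
Proof.
rewrite pair_big (reindex (fun u : 'I_m * 'I_n => idx u)) /=; last first.
  exists (@mxtens.mxtens_unindex m n) => x _; [exact: mxtens.mxtens_indexK|].
  exact: mxtens.mxtens_unindexK.
by apply: eq_bigr => -[i j].
Qed.

Lemma mul_tensmx1 m n p (A : 'M[C]_m) (X : 'M[C]_(m * n, p)) a b y :
  (tensmx A (1%:M : 'M[C]_n) *m X) (idx (a, b)) y = \sum_k A a k * X (idx (k, b)) y.
Proof.
rewrite mxE sum_idx; apply: eq_bigr => k _.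
rewrite (bigD1 b) //= big1 ?addr0 => [|l lb].
  by rewrite mxtens.tensmxE mxE eqxx mulr1.
by rewrite mxtens.tensmxE mxE eq_sym (negPf lb) mulr0 mul0r.
Qed.

Lemma type_of_info_tens dA dB N (Z : 'I_N -> 'M[C]_dA) : type_of_info Z ->
  type_of_info (fun j => tensmx (Z j) (1%:M : 'M[C]_dB)).
Proof.
move=> [hZ oZ sZ]; split=> [j|j k|].
- rewrite /Defs.hermitian /dag mxtens.map_mxT mxtens.trmx_tens.
  by rewrite map_mx1 trmx1 -[in RHS]hZ.
- rewrite mxtens.tensmx_mul oZ mulmx1; case: eqP => // _; exact: mxtens.tens0mx.
- apply/matrixP => x y.
  case: (mxtens.mxtens_indexP x) (mxtens.mxtens_indexP y) => a b [a' b'].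
  rewrite summxE (eq_bigr (fun j => Z j a a' * (1%:M : 'M[C]_dB) b b')); last first.
    by move=> j _; rewrite mxtens.tensmxE.
  rewrite -mulr_suml -summxE sZ !mxE -natrM mulnb.
  by rewrite (can_eq (@mxtens.mxtens_indexK _ _)) xpair_eqE.
Qed.

Section Info.
Variables (dA dB dC N : nat) (psi : 'cV[C]_(dA * dB * dC)) (Z : 'I_N -> 'M[C]_dA).
Hypothesis hZ : type_of_info Z.

Let rho := psi *m dag psi.
Let P j : 'M[C]_(dA * dB) := tensmx (Z j) 1%:M.
Let hP : type_of_info P := type_of_info_tens dB hZ.

(* The amplitudes of psi, as an operator from C to AB. *)
Definition amp : 'M[C]_(dA * dB, dC) := \matrix_(x, c) psi (idx (x, c)) 0.
Let M := amp.

Lemma rhoE x y : rho x y = psi x 0 * (psi y 0)^*.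
Proof. by rewrite mxE big_ord1 dagE. Qed.

Lemma rho_ABE : rho_AB rho = M *m dag M.
Proof.
apply/matrixP => x y; rewrite !mxE; apply: eq_bigr => c _.
by rewrite rhoE dagE !mxE.
Qed.

(** The transpose arises because [rho] conjugates the amplitude with the column index, whereas
    [dag M *m M] conjugates the one with the row index. *)
Lemma rho_CE : rho_C rho = (dag M *m M)^T.
Proof.
apply/matrixP => k l; rewrite !mxE; apply: eq_bigr => x _.
by rewrite rhoE dagE !mxE mulrC.
Qed.

Lemma cond_blockE j : cond_block rho Z j = (dag M *m P j *m M)^T.
Proof.
apply/matrixP => k l; rewrite [RHS]mxE -mulmxA [LHS]mxE [RHS]mxE sum_idx; apply: eq_bigr => a _.
rewrite mul_tensmx1.
transitivity (\sum_a' \sum_b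
    Z j a a' * (psi (idx (idx (a', b), k)) 0 * (psi (idx (idx (a, b), l)) 0)^*)).
  apply: eq_bigr => a' _; rewrite mxE mulr_sumr; apply: eq_bigr => b _.
  by rewrite !mxtens.mxtens_indexK rhoE.
rewrite exchange_big; apply: eq_bigr => b _ /=.
rewrite mul_tensmx1 mulr_sumr; apply: eq_bigr => a' _.
by rewrite dagE !mxE [RHS]mulrC mulrA.
Qed.

(* V_Z psi, as an operator from (M_Z, C) to AB. *)
Definition meas_amp : 'M[C]_(dA * dB, N * dC) :=
  \matrix_(x, k) (P (mxtens.mxtens_unindex k).1 *m M) x (mxtens.mxtens_unindex k).2.
Let X := meas_amp.

(** The block of [dag X *m X] at (j2, j1) is M^* P_j2 P_j1 M, so orthogonality of the projectors
    makes it block diagonal, with the transposed conditional blocks on the diagonal. *)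
Lemma rho_MZCE : rho_MZC rho Z = (dag X *m X)^T.
Proof.
have [hermP orthP _] := hP.
apply/matrixP => k l.
case: (mxtens.mxtens_indexP k) (mxtens.mxtens_indexP l) => j1 c1 [j2 c2].
rewrite summxE [RHS]mxE.
have -> : (dag X *m X) (idx (j2, c2)) (idx (j1, c1)) = (dag M *m (P j2 *m P j1) *m M) c2 c1.
  transitivity ((dag (P j2 *m M) *m (P j1 *m M)) c2 c1).
    by rewrite !mxE; apply: eq_bigr => x _; rewrite !dagE !mxE !mxtens.mxtens_indexK.
  by rewrite dagM hermP !mulmxA.
rewrite (bigD1 j1) //= big1 ?addr0 => [|j jj1]; last first.
  by rewrite mxtens.tensmxE mxE [j1 == j]eq_sym (negPf jj1) mul0r.
rewrite mxtens.tensmxE mxE eqxx /= orthP.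
have [->|_] := eqVneq j2 j1; last by rewrite mulmx0 mul0mx mul0r mxE.
by rewrite mul1r cond_blockE mxE.
Qed.

Lemma meas_amp_gram : X *m dag X = pinch P (M *m dag M).
Proof.
have [hermP _ _] := hP.
apply/matrixP => x y; rewrite mxE sum_idx summxE; apply: eq_bigr => j _.
have -> : P j *m (M *m dag M) *m P j = P j *m M *m dag (P j *m M).
  by rewrite dagM hermP !mulmxA.
rewrite mxE; apply: eq_bigr => c _.
by rewrite !dagE !mxE !mxtens.mxtens_indexK.
Qed.

Lemma tr_amp : dag psi *m psi = 1 -> \tr (dag M *m M) = 1.
Proof.
move=> h; have -> : \tr (dag M *m M) = \tr (M *m dag M) by rewrite mxtrace_mulC.
have : (dag psi *m psi) 0 0 = 1 by rewrite h mxE eqxx.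
rewrite mxE sum_idx => <-; apply: eq_bigr => x _; rewrite mxE; apply: eq_bigr => c _.
by rewrite !dagE !mxE mulrC.
Qed.

End Info.

(** Complementary marginals of a pure state have equal entropy: [tr_mfun_gram] applies to x log2 x,
    which vanishes at 0, and transposition preserves the trace. *)
Lemma vN_entropy_gram_tr m n (X : 'M[C]_(m, n)) :
  vN_entropy (dag X *m X)^T = vN_entropy (X *m dag X).
Proof.
have h1 : Defs.hermitian (X *m dag X) by rewrite /Defs.hermitian dagM dagK.
have h2 : Defs.hermitian (dag X *m X) by rewrite /Defs.hermitian dagM dagK.
rewrite !vN_entropyE mfun_tr // -trmx_mul mxtrace_tr mxtrace_mulC; congr (- reC _).
have e k (A : 'M[C]_k) : Defs.hermitian A ->
    A *m mfun (@log2 R) A = mfun (fun x => x * log2 x) A.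
  by move=> hA; rewrite -{1}(mfun_id hA) mfunM.
by rewrite !e // tr_mfun_gram // mul0r.
Qed.

Lemma tr_sqr_gram_tr m n (X : 'M[C]_(m, n)) :
  \tr ((dag X *m X)^T *m (dag X *m X)^T) = \tr ((X *m dag X) *m (X *m dag X)).
Proof. by rewrite -trmx_mul mxtrace_tr !mulmxA mxtrace_mulC !mulmxA. Qed.

Lemma sup_maximum (S : set R) c : S c -> ubound S c -> sup S = c.
Proof.
move=> Sc ubc; apply/eqP; rewrite eq_le; apply/andP; split.
  by apply: ge_sup => //; exists c.
by apply: ub_le_sup => //; exists c.
Qed.

End Tripartite.

Theorem theorem1 (R : realType) (dA dB dC N : nat)
    (rho : 'M[R[i]]_(dA * dB * dC)) (Z : 'I_N -> 'M[R[i]]_dA) :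
  pure_state rho -> type_of_info Z ->
  [/\ (* (i) H(Z|C) = min_sigma D(rho_AB || sum_j Z_j sigma Z_j) *)
      (exists2 sigma : 'M[R[i]]_(dA * dB), density sigma &
         ((cond_entropy rho Z)%:E
          = rel_entropy (rho_AB rho) (dephase Z sigma))%E)
      /\ (forall sigma : 'M[R[i]]_(dA * dB), density sigma ->
         ((cond_entropy rho Z)%:E
          <= rel_entropy (rho_AB rho) (dephase Z sigma))%E),
      (* (ii) H_Q(Z|C) = min_sigma D_HS(rho_AB, sum_j Z_j sigma Z_j) *)
      (exists2 sigma : 'M[R[i]]_(dA * dB), density sigma &
         cond_entropy_Q rho Z = D_HS (rho_AB rho) (dephase Z sigma))
      /\ (forall sigma : 'M[R[i]]_(dA * dB), density sigma ->
         cond_entropy_Q rho Z <= D_HS (rho_AB rho) (dephase Z sigma))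
    & (* (iii) p_guess(Z|C) = max_sigma F(rho_AB, sum_j Z_j sigma Z_j) *)
      (exists2 sigma : 'M[R[i]]_(dA * dB), density sigma &
         p_guess rho Z = fidelity (rho_AB rho) (dephase Z sigma))
      /\ (forall sigma : 'M[R[i]]_(dA * dB), density sigma ->
         fidelity (rho_AB rho) (dephase Z sigma) <= p_guess rho Z)].
Proof.
move=> [psi [psi1 ->]] hZ.
set rho' := psi *m dag psi; pose M := amp psi.
pose P j : 'M[R[i]]_(dA * dB) := tensmx (Z j) 1%:M.
have hP : type_of_info P := type_of_info_tens dB hZ.
have dephaseE s : dephase Z s = pinch P s by [].
have trM : \tr (dag M *m M) = 1 by exact: tr_amp.
have dAB : density (M *m dag M).
  by split; [rewrite -{1}[M]dagK; exact: psd_gram | rewrite mxtrace_mulC].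
have [pAB _] := dAB.
(* An empty family of projectors would force the identity to be 0, against the unit trace of the
   state. *)
have N_gt0 : (0 < N)%N.
  rewrite lt0n; apply/negP => /eqP N0.
  have P1 : 1%:M = 0 :> 'M[R[i]]_(dA * dB).
    by have [_ _ <-] := hP; rewrite big1 // => j _; have := leq_trans (ltn_ord j) (eq_leq N0).
  have : \tr (dag M *m M) = 0 by rewrite -[M]mul1mx P1 mul0mx mulmx0 mxtrace0.
  by rewrite trM => /eqP; rewrite oner_eq0.
have HE : cond_entropy rho' Z = vN_entropy (pinch P (M *m dag M)) - vN_entropy (M *m dag M).
  by rewrite /cond_entropy rho_MZCE // rho_CE !vN_entropy_gram_tr meas_amp_gram.
have HQE : cond_entropy_Q rho' Z =
    reC (\tr ((M *m dag M) *m (M *m dag M)))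
    - reC (\tr (pinch P (M *m dag M) *m pinch P (M *m dag M))).
  by rewrite /cond_entropy_Q rho_MZCE // rho_CE !tr_sqr_gram_tr meas_amp_gram.
rewrite rho_ABE; split.
- rewrite HE; split; last by move=> s ds; rewrite dephaseE; exact: rel_entropy_pinch_ge.
  by exists (M *m dag M) => //; rewrite dephaseE rel_entropy_pinch.
- rewrite HQE; split; last first.
    move=> s [[hs _] _]; rewrite dephaseE D_HS_pinch // lerDl.
    (* [D_HS] is the trace of a square; it is a squared norm here because both pinched matrices are
       Hermitian. *)
    have := tr_dag_mul_ge0 (pinch P (M *m dag M) - pinch P s).
    rewrite dagB.
    have [[-> _] _] := density_pinch hP dAB.
    have -> : dag (pinch P s) = pinch P s.
      rewrite dag_sum; apply: eq_bigr => j _.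
      by rewrite !dagM hs; have [-> _ _] := hP; rewrite mulmxA.
    exact: reC_ge0.
  by exists (M *m dag M) => //; rewrite dephaseE D_HS_pinch // /D_HS subrr mulmx0 mxtrace0 addr0.
- pose W j := dag M *m P j *m M.
  have [Q [pQ Q1] Qmax] := optimal_povm W N_gt0.
  (* The conditional blocks are the transposes of the [W j], so POVMs are transposed to carry values
     from one family to the other. *)
  have povm_tr (Q' : 'I_N -> 'M[R[i]]_dC) : povm Q' -> povm (fun j => (Q' j)^T).
    move=> [pQ' Q1']; split=> [j|]; first exact: psd_tr.
    rewrite -[RHS]trmx1 -Q1'; apply/matrixP => a b.
    by rewrite mxE !summxE; apply: eq_bigr => j _; rewrite mxE.
  have trW (Q' : 'I_N -> 'M[R[i]]_dC) :
      \sum_j \tr (Q' j *m cond_block rho' Z j) = \sum_j \tr ((Q' j)^T *m W j).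
    apply: eq_bigr => j _; rewrite cond_blockE -[in LHS](trmxK (Q' j)) -trmx_mul.
    by rewrite mxtrace_tr mxtrace_mulC.
  have -> : p_guess rho' Z = reC (\sum_j \tr (Q j *m W j)).
    apply: sup_maximum.
      exists (fun j => (Q j)^T); split; first exact: povm_tr.
      by rewrite trW; congr reC; apply: eq_bigr => j _; rewrite trmxK.
    by move=> x [Q' [pQ' ->]]; rewrite trW; exact/Qmax/povm_tr.
  have fid_le s : density s ->
      fidelity (M *m dag M) (dephase Z s) <= reC (\sum_j \tr (Q j *m W j)).
    move=> ds; have [Q' pQ' le1] := fidelity_pinch_le M hP (Ordinal N_gt0) ds.
    by apply: le_trans le1 _; exact: Qmax.
  split=> //; have [s ds les] := fidelity_pinch_ge hP trM (conj pQ Q1).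
  by exists s => //; apply/eqP; rewrite eq_le fid_le // les.
Qed.
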